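(* Let $n,s,t\in\mathbb{N}=\{0,1,2,\ldots\}$ with $t$ odd. Then $$E_{2n}(q)-E_{2n+2^st}(q)\equiv [2^s]_{q^t}\ \left(\mathrm{mod}\ (1+q)[2^s]_{q^t}\right)$$ in $\mathbb{Z}[q]$, i.e. $(1+q)[2^s]_{q^t}$ divides $E_{2n}(q)-E_{2n+2^st}(q)-[2^s]_{q^t}$ in $\mathbb{Z}[q]$.
   Context: For $n\in\mathbb{N}$, $(a;q)_n=\prod_{0\le k<n}(1-aq^k)$ (so $(a;q)_0=1$), and $[n]_q=\frac{1-q^n}{1-q}=\sum_{0\le k<n}q^k$; thus $[2^s]_{q^t}=\frac{1-q^{2^st}}{1-q^t}$. The $q$-Euler numbers $E_n(q)$ ($n\in\mathbb{N}$) are defined by the formal power series identity $$\sum_{n=0}^{\infty}E_{n}(q)\frac{x^{n}}{(q;q)_{n}}=\Big(\sum_{n=0}^{\infty}\frac{q^{\binom{2n}{2}}x^{2n}}{(q;q)_{2n}}\Big)^{-1};$$ they are polynomials in $q$ with integer coefficients. *)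

(* Defs.v *)
From mathcomp Require Import all_boot all_order all_algebra.

Set Implicit Arguments.
Unset Strict Implicit.
Unset Printing Implicit Defensive.

Import GRing.Theory.
Local Open Scope ring_scope.

Definition qpoch (R : pzRingType) (a q : R) (n : nat) : R :=
  \prod_(k < n) (1 - a * q ^+ k).

(* The polynomial form of (1 - q^n) / (1 - q), which makes sense in any ring. *)
Definition qint (R : pzRingType) (q : R) (n : nat) : R :=
  \sum_(k < n) q ^+ k.

(* A formal power series in x over R is its sequence of coefficients. *)
Definition fps (R : pzRingType) := nat -> R.

Definition fps_one (R : pzRingType) : fps R := fun m => (m == 0%N)%:R.

Definition fps_mul (R : pzRingType) (F G : fps R) : fps R :=
  fun m => \sum_(i < m.+1) F i * G (m - i)%N.

(* F = G^-1 in R[[x]], for a commutative R. *)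
Definition fps_is_inverse (R : comPzRingType) (F G : fps R) : Prop :=
  fps_mul F G =1 @fps_one R.

(* Z[q] is {poly int} with q = 'X; the generating functions have coefficients
   in its field of fractions Q(q). *)
Definition Qq := {fraction {poly int}}.

Definition qQ : Qq := tofrac 'X.

(* \sum_n E_n x^n / (q;q)_n *)
Definition qegf (E : nat -> {poly int}) : fps Qq :=
  fun n => tofrac (E n) / qpoch qQ qQ n.

(* \sum_n q^C(2n,2) x^(2n) / (q;q)_(2n) : the coefficient of x^m is nonzero
   only for even m = 2n. *)
Definition qcosh : fps Qq :=
  fun m => if odd m then 0 else qQ ^+ 'C(m, 2) / qpoch qQ qQ m.

(* E is the sequence of q-Euler numbers; see qEuler_exists and qEuler_unique. *)
Definition is_qEuler (E : nat -> {poly int}) : Prop :=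
  fps_is_inverse (qegf E) qcosh.

(* Divisibility in Z[q]. The library relation %| on polynomials is
   pseudo-divisibility, hence divisibility in Q[q] here, which is weaker. *)
Definition dvdZq (d p : {poly int}) : Prop := exists c : {poly int}, p = d * c.

Definition eqmodZq (d a b : {poly int}) : Prop := dvdZq d (a - b).

Section ExistenceUniqueness.

Local Notation P := (qpoch ('X : {poly int}) 'X).

Fixpoint qbin (n k : nat) : {poly int} :=
  match n, k with
  | _, 0 => 1
  | 0, _.+1 => 0
  | n'.+1, k'.+1 => qbin n' k' + 'X^(k'.+1) * qbin n' k'.+1
  end.

Lemma qpochS n : P n.+1 = P n * (1 - 'X^(n.+1)).
Proof. by rewrite /qpoch big_ord_recr /= exprS. Qed.

Lemma qbin0 n : qbin n 0 = 1. Proof. by case: n. Qed.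

Lemma qbin_small n k : (n < k)%N -> qbin n k = 0.
Proof.
elim: n k => [|n IHn] [|k] //= lt_nk.
by rewrite !IHn ?mulr0 ?addr0 // ltnW.
Qed.

Lemma qbin_qpoch k j : qbin (k + j) k * P k * P j = P (k + j).
Proof.
have [n] := ubnP (k + j); elim: n k j => // n IHn [|k] j lt_n.
  by rewrite add0n qbin0 {1}/qpoch big_ord0 !mul1r.
rewrite addSn /= 2!mulrDl.
have -> : qbin (k + j) k * P k.+1 * P j = P (k + j) * (1 - 'X^(k.+1)).
  by rewrite qpochS mulrA mulrAC IHn.
case: j lt_n => [|j] lt_n.
  by rewrite addn0 qbin_small // mulr0 !mul0r addr0 -qpochS.
have -> : 'X^(k.+1) * qbin (k + j.+1) k.+1 * P k.+1 * P j.+1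
   = P (k + j.+1) * ('X^(k.+1) * (1 - 'X^(j.+1))).
  rewrite (qpochS j) addnS -addSn -IHn; last by rewrite addSnnS -ltnS.
  by rewrite -!mulrA; do 3!(rewrite [LHS]mulrCA; congr (_ * _)).
rewrite qpochS -mulrDr; congr (_ * _).
by rewrite mulrBr mulr1 -exprD addrA subrK addSn.
Qed.

Lemma tofrac_qpoch n : qpoch qQ qQ n = tofrac (P n).
Proof.
rewrite /qpoch rmorph_prod; apply: eq_bigr => i _.
by rewrite rmorphB rmorphM rmorphXn rmorph1.
Qed.

Lemma qpoch_neq0 n : qpoch qQ qQ n != 0.
Proof.
rewrite tofrac_qpoch tofrac_eq0; elim: n => [|n IHn].
  by rewrite /qpoch big_ord0 oner_eq0.
rewrite qpochS mulf_neq0 // subr_eq0 eq_sym.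
by apply/eqP=> /(congr1 (fun p : {poly int} => p`_0)); rewrite coefXn coef1.
Qed.

Lemma qcosh0 : qcosh 0 = 1.
Proof. by rewrite /qcosh /= bin_small // /qpoch big_ord0 divr1. Qed.

Let g m : {poly int} := if odd m then 0 else 'X^('C(m, 2)).

Let next (s : seq {poly int}) : {poly int} :=
  (nilp s)%:R - \sum_(i < size s) s`_i * (g (size s - i) * qbin (size s) i).

Fixpoint qEuler_seq n : seq {poly int} :=
  if n is n'.+1 then rcons (qEuler_seq n') (next (qEuler_seq n')) else [::].

Let E n := (qEuler_seq n.+1)`_n.

Let size_seq n : size (qEuler_seq n) = n.
Proof. by elim: n => //= n IHn; rewrite size_rcons IHn. Qed.

Let nth_seq n i : (i < n)%N -> (qEuler_seq n)`_i = E i.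
Proof.
elim: n => // n IHn; rewrite ltnS leq_eqVlt => /predU1P[-> //|lt_in].
by rewrite /= nth_rcons size_seq lt_in IHn.
Qed.

Let E_rec n :
  E n = (n == 0%N)%:R - \sum_(i < n) E i * (g (n - i) * qbin n i).
Proof.
rewrite {1}/E /= nth_rcons size_seq ltnn eqxx /next /nilp size_seq.
by congr (_ - _); apply: eq_bigr => i _; rewrite nth_seq.
Qed.

Lemma qEuler_exists : exists E : nat -> {poly int}, is_qEuler E.
Proof.
exists E => m; rewrite /fps_mul /fps_one.
rewrite big_ord_recr /= subnn qcosh0 mulr1 /qegf E_rec rmorphB mulrBl.
rewrite rmorph_sum mulr_suml addrC -addrA -sumrN -[RHS]addr0.
congr (_ + _).
  case: m => [|m]; last by rewrite rmorph0 mul0r.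
  by rewrite /qpoch big_ord0 divr1 rmorph1.
rewrite -big_split big1 // => i _ /=; apply/eqP.
rewrite addrC subr_eq0; apply/eqP.
have le_im : (i <= m)%N by apply/ltnW.
have qbE : tofrac (qbin m i) / qpoch qQ qQ m
    = (qpoch qQ qQ i)^-1 * (qpoch qQ qQ (m - i))^-1.
  have := congr1 (@tofrac _) (qbin_qpoch i (m - i)).
  rewrite subnKC // !rmorphM /= -!tofrac_qpoch => qbP.
  have := qpoch_neq0 m.
  rewrite -qbP !mulf_eq0 !negb_or => /andP[/andP[qb0 _] _].
  by rewrite -mulrA invfM mulVKf // invfM.
rewrite !rmorphM -!mulrA qbE; congr (_ * _); rewrite mulrCA; congr (_ * _).
rewrite /qcosh /g; case: ifP => _; first by rewrite rmorph0 mul0r.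
by rewrite rmorphXn.
Qed.

Lemma qEuler_unique (E1 E2 : nat -> {poly int}) :
  is_qEuler E1 -> is_qEuler E2 -> E1 =1 E2.
Proof.
move=> E1P E2P n; have [m] := ubnP n; elim: m n => // m IHm n lt_nm.
have := etrans (E1P n) (esym (E2P n)); rewrite /fps_mul !big_ord_recr /=.
rewrite subnn qcosh0 !mulr1.
under eq_bigr => i _ do rewrite /qegf IHm ?(leq_trans (ltn_ord i)) //.
move/addrI/(mulIf (invr_neq0 (qpoch_neq0 n)))/eqP.
by rewrite tofrac_eq => /eqP.
Qed.

End ExistenceUniqueness.

(* Main.v *)
(* The defining identity gives the recurrence
   sum_i [m choose i]_q q^C(m-i,2) E_i = [m = 0] (i = m mod 2) in Z[q].
   If q is specialized to a primitive e-th root of unity with e even, the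
   q-binomials satisfy [n+e choose k] = [n choose k] + [n choose k-e] and
   q^C(m+e,2) = - q^C(m,2), so the recurrence forces E_{n+e} = E_n there.
   The complex roots of [2^s]_{q^t} are exactly the (2^s t)-th roots of unity
   of even order (they are simple), whence [2^s]_{q^t} divides
   E_{2n} - E_{2n + 2^s t}.  Let f be the quotient.  The remaining factor 1 + q
   amounts to f(-1) = 1.  For s = 0 this is E_{2n}(-1) = 1; for s > 0 it follows
   by differentiating at q = -1, where [2^s]_{q^t} vanishes with derivative
   2^(s-1) t, from E_{2n}'(-1) = -n, itself obtained by differentiating the
   recurrence. *)
Require Import Defs.
From mathcomp Require Import all_boot all_order all_algebra all_field.
From mathcomp Require Import ring lra zify.

Set Implicit Arguments.
Unset Strict Implicit.
Unset Printing Implicit Defensive.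

Import GRing.Theory.
Local Open Scope ring_scope.

(** * The recurrence in Z[q] *)

Notation P := (qpoch ('X : {poly int}) 'X).

(* The numerators of the coefficients of qcosh, moved from Q(q) to Z[q]. *)
Definition qcosh_num (m : nat) : {poly int} :=
  if odd m then 0 else 'X^('C(m, 2)).

Lemma tofrac_qbin k j : tofrac (qbin (k + j) k) / qpoch qQ qQ (k + j) =
  (qpoch qQ qQ k)^-1 * (qpoch qQ qQ j)^-1.
Proof.
have := congr1 (@tofrac _) (qbin_qpoch k j).
rewrite !rmorphM /= -!tofrac_qpoch => qbP.
have := qpoch_neq0 (k + j); rewrite -qbP !mulf_eq0 !negb_or.
by move=> /andP[/andP[qb0 _] _]; rewrite -mulrA invfM mulVKf // invfM.
Qed.

(** This compares coefficients of x^m in the defining identity and multiplies by (q;q)_m, which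
    turns the quotients of q-factorials into q-binomials. Injectivity of [tofrac] brings the result
    back to Z[q]. *)
Lemma qEuler_rec E m : is_qEuler E ->
  \sum_(i < m.+1) E i * (qcosh_num (m - i) * qbin m i) = (m == 0%N)%:R.
Proof.
move=> hE; apply/eqP; rewrite -tofrac_eq; apply/eqP.
have PV : (qpoch qQ qQ m)^-1 != 0 by rewrite invr_neq0 // qpoch_neq0.
apply: (mulIf PV); have -> : tofrac (m == 0%N)%:R / qpoch qQ qQ m = fps_one Qq
  m.
  by rewrite /fps_one; case: m {PV} => [|m];
     rewrite ?rmorph0 ?mul0r // /qpoch big_ord0 divr1 rmorph1.
rewrite -hE /fps_mul rmorph_sum mulr_suml; apply: eq_bigr => i _ /=.
have -> : qcosh (m - i)%N = tofrac (qcosh_num (m - i)%N) / qpoch qQ qQ (m -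
  i)%N.
  rewrite /qcosh /qcosh_num; case: ifP => _; first by rewrite rmorph0 mul0r.
  by rewrite rmorphXn.
rewrite /qegf !rmorphM -!mulrA; congr (_ * _); rewrite [RHS]mulrCA;
  congr (_ * _).
by have := tofrac_qbin i (m - i)%N; rewrite subnKC ?leq_ord.
Qed.

Lemma qbinn n : qbin n n = 1.
Proof. by elim: n => //= n ->; rewrite qbin_small // mulr0 addr0. Qed.

Lemma qcosh_num0 : qcosh_num 0 = 1.
Proof. by rewrite /qcosh_num /= expr0. Qed.

(** In the recurrence for odd [m], a term with [i < m] dies by induction if [i] is odd, and because
    [m - i] is odd otherwise. *)
Lemma qEuler_odd E m : is_qEuler E -> odd m -> E m = 0.
Proof.
move=> hE; elim/ltn_ind: m => m IHm om; have := qEuler_rec m hE.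
rewrite big_ord_recr /= subnn qcosh_num0 mul1r qbinn mulr1 big1 => [|i _].
  by rewrite add0r => ->; case: m om {IHm}.
have [oi|ei] := boolP (odd i); first by rewrite IHm ?mul0r.
by rewrite /qcosh_num oddB ?(ltnW (ltn_ord i)) // om (negPf ei) mul0r mulr0.
Qed.

(** * Specialization of q to a primitive [e]-th root of unity *)

Section RootOfUnity.

Variables (R : idomainType) (phi : {rmorphism {poly int} -> R}) (e : nat).
Hypothesis prim_q : e.-primitive_root (phi 'X).

Let e_gt0 : (0 < e)%N := prim_order_gt0 prim_q.

Lemma qpoch_prim_neq0 k : (k < e)%N -> phi (P k) != 0.
Proof.
move=> lt_ke; rewrite /qpoch rmorph_prod; apply/prodf_neq0 => i _.
rewrite -exprS rmorphB rmorphXn rmorph1 subr_eq0 eq_sym.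
rewrite -(prim_order_dvd prim_q); apply/negP => /dvdn_leq-/(_ isT).
by rewrite leqNgt (leq_ltn_trans (ltn_ord i) lt_ke).
Qed.

Lemma qpoch_prim_eq0 : phi (P e) = 0.
Proof.
rewrite -(prednK e_gt0) qpochS rmorphM rmorphB rmorphXn rmorph1 prednK //.
by rewrite (prim_expr_order prim_q) subrr mulr0.
Qed.

Lemma qbin_prim k : (0 < k < e)%N -> phi (qbin e k) = 0.
Proof.
case/andP=> k0 ke; have := congr1 phi (qbin_qpoch k (e - k)).
rewrite subnKC ?(ltnW ke) // qpoch_prim_eq0 !rmorphM => /eqP.
rewrite mulf_eq0 mulf_eq0 (negPf (qpoch_prim_neq0 ke)) orbF => /orP[/eqP//|].
by rewrite (negPf (qpoch_prim_neq0 _)) // -subn_gt0 subKn // ltnW.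
Qed.

(** A case of the q-Lucas theorem. Both sides obey the q-Pascal rule in [n], since q^e = 1, and they
    agree at [n = 0] because the inner q-binomials [e choose k] vanish. *)
Lemma qbin_shift n k : phi (qbin (n + e) k) =
  phi (qbin n k) + (if (e <= k)%N then phi (qbin n (k - e)) else 0).
Proof.
elim: n k => [|n IHn] [|k].
- by rewrite !qbin0 leqNgt e_gt0 addr0.
- rewrite add0n (qbin_small (ltn0Sn k)) rmorph0 add0r;
  case: (ltngtP e k.+1) => [lt_ek|gt_ek|<-].
  + by rewrite qbin_small // rmorph0 qbin_small ?rmorph0 // subn_gt0.
  + by rewrite qbin_prim // gt_ek.
  + by rewrite subnn qbinn.
- by rewrite !qbin0 leqNgt e_gt0 addr0.
rewrite addSn /= !rmorphD !rmorphM !IHn mulrDr addrACA; congr (_ + _).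
case: (ltngtP e k.+1) => [lt_ek|gt_ek|eq_ek].
- rewrite -ltnS lt_ek subSn // -?ltnS // /= rmorphD rmorphM; congr (_ + _ * _).
  rewrite -(subnK (_ : e <= k.+1)%N) 1?ltnW // exprD rmorphM.
  by rewrite [phi 'X^e]rmorphXn (prim_expr_order prim_q) mulr1 subSn // -ltnS.
- by rewrite leqNgt -ltnS ltnW //= mulr0 addr0.
- rewrite -eq_ek leqNgt -ltnS -eq_ek ltnS leqnn /= add0r subnn !qbin0 rmorph1
  rmorphXn.
  by rewrite (prim_expr_order prim_q) mulr1.
Qed.

Hypothesis even_e : ~~ odd e.

Lemma qcosh_num_shift m : phi (qcosh_num (m + e)) = - phi (qcosh_num m).
Proof.
rewrite /qcosh_num oddD (negPf even_e) addbF; case: ifP => _.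
  by rewrite rmorph0 oppr0.
have binE : 'C(m + e, 2) = ('C(m, 2) + m * e + 'C(e, 2))%N.
  elim: m => [|m IHm]; first by rewrite add0n (@bin_small 0).
  by rewrite addSn !binS !bin1 IHm; lia.
(* A square root of 1 in a domain is 1 or -1, and primitivity excludes 1. *)
have qe2 : phi 'X ^+ e./2 = -1.
  have : phi 'X ^+ e./2 ^+ 2 == 1.
    by rewrite -exprM muln2 even_halfK // (prim_expr_order prim_q).
  rewrite -subr_eq0 subr_sqr_1 mulf_eq0 subr_eq0 addr_eq0 => /orP[|/eqP//].
  rewrite -(prim_order_dvd prim_q) => /dvdn_leq; rewrite half_gt0; lia.
have qbine : phi 'X ^+ 'C(e, 2) = -1.
  (* C(e,2) = (e/2)(e-1) with [e - 1] odd. *)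
  rewrite bin2 -divn2 mulnC -muln_divA ?dvdn2 // divn2 mulnC exprM qe2.
  by rewrite -signr_odd -subn1 oddB // (negPf even_e) expr1.
rewrite binE !exprD !rmorphM !rmorphXn qbine mulrN1; congr (- _).
by rewrite mulnC exprM (prim_expr_order prim_q) expr1n mulr1.
Qed.

Lemma qEuler_shift E n : is_qEuler E -> phi (E (n + e)%N) = phi (E n).
Proof.
move=> hE; pose B k j := phi (qcosh_num (k - j)) * phi (qbin k j).
(* The recurrence at [k + e] splits by [qbin_shift] into [S1], minus the unshifted sum, and [S2],
   the shifted one. *)
have shiftE k : \sum_(i < k.+1) phi (E (i + e)%N) * B k i =
                \sum_(i < k.+1) phi (E i) * B k i.
  have := congr1 phi (qEuler_rec (k + e) hE).
  rewrite addn_eq0 (negPf (lt0n_neq0 e_gt0)) andbF rmorph0 rmorph_sum.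
  under eq_bigr => i _ do rewrite !rmorphM qbin_shift !mulrDr.
  rewrite big_split /=; set S1 := (X in X + _); set S2 := (X in _ + X).
  have -> : S1 = - \sum_(i < k.+1) phi (E i) * B k i.
    rewrite /S1 -(big_mkord xpredT (fun i =>
      phi (E i) * (phi (qcosh_num (k + e - i)) * phi (qbin k i)))).
    rewrite (big_cat_nat (n := k.+1)) ?ltnS ?leq_addr //=.
    rewrite [X in _ + X]big_nat_cond [X in _ + X]big1 => [|i]; last first.
      by rewrite andbT => /andP[lt_ki _]; rewrite qbin_small // rmorph0 !mulr0.
    rewrite addr0 big_mkord -sumrN; apply: eq_bigr => i _.
    by rewrite -addnBAC ?leq_ord // qcosh_num_shift mulNr mulrN.
  have -> : S2 = \sum_(i < k.+1) phi (E (i + e)%N) * B k i.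
    rewrite /S2 -(big_mkord xpredT (fun i => phi (E i) *
      (phi (qcosh_num (k + e - i)) * if (e <= i)%N then phi (qbin k (i - e))
        else 0))).
    rewrite (big_cat_nat (n := e)) ?leq_addl // -?addSn ?leq_addl //=.
    rewrite big_nat_cond big1 => [|i]; last first.
      by rewrite andbT => /andP[_ lt_ie]; rewrite leqNgt lt_ie !mulr0.
    rewrite add0r -{1}[e]add0n big_addn addnK big_mkord; apply: eq_bigr => i _.
    by rewrite leq_addl addnK subnDr.
  by move/eqP; rewrite addrC subr_eq0 => /eqP.
(* By induction the two sums agree term by term except at the last index, where the coefficient is
   1. *)
elim/ltn_ind: n => n IHn; have := shiftE n; rewrite !big_ord_recr /=.
under eq_bigr => i _ do rewrite IHn //.
by move/addrI; rewrite /B subnn qcosh_num0 qbinn !rmorph1 !mulr1.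
Qed.

End RootOfUnity.

(** * Divisibility by [2^s]_{q^t} *)

(** Division by a monic polynomial stays over [R]. The image of the remainder is still divisible by
    that of [d] but has smaller size, so it is zero. *)
Lemma monic_dvd_map (R S : idomainType) (f : {rmorphism R -> S}) (p d : {poly
  R}) :
  injective f -> d \is monic -> map_poly f d %| map_poly f p ->
  exists c, p = d * c.
Proof.
move=> f_inj d_monic.
rewrite {1}(Pdiv.RingMonic.rdivp_eq d_monic p) rmorphD rmorphM /=.
set r := Pdiv.CommonRing.rmodp p d.
rewrite dvdp_addr ?dvdp_mull // => d_r.
exists (Pdiv.CommonRing.rdivp p d).
rewrite {1}(Pdiv.RingMonic.rdivp_eq d_monic p) mulrC -/r.
have [->|r0] := eqVneq r 0; first by rewrite addr0.
have := dvdp_leq _ d_r; rewrite map_poly_eq0_id0; last first.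
  by rewrite -(rmorph0 f) (inj_eq f_inj) lead_coef_eq0.
rewrite r0 !size_map_inj_poly ?rmorph0 // => /(_ isT).
by rewrite leqNgt Pdiv.CommonRing.ltn_rmodp ?monic_neq0.
Qed.

Lemma qint_dvd_qEuler E n s t : is_qEuler E -> odd t ->
  exists f : {poly int}, E n - E (n + 2 ^ s * t)%N = qint 'X^t (2 ^ s) * f.
Proof.
move=> hE odd_t; set N := (2 ^ s * t)%N; set D := E n - _.
have N_gt0 : (0 < N)%N by rewrite /N muln_gt0 expn_gt0 /= odd_gt0.
have qintE : 'X^N - 1 = ('X^t - 1) * qint 'X^t (2 ^ s) :> {poly int}.
  by rewrite -subrX1 -exprM mulnC.
(* The factor q^t - 1 completes the divisor to q^N - 1, whose complex roots are the distinct powers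
   of one primitive root [z]. *)
have [f Df] : exists f, ('X^t - 1) * D = ('X^N - 1) * f.
  apply: (@monic_dvd_map int algC intr) => //; first exact: intr_inj.
    by rewrite monicE lead_coefDl ?lead_coefXn // size_polyXn size_polyN
      size_poly1 ltnS.
  have [z prim_z] := C_prim_root_exists N_gt0.
  rewrite rmorphB rmorphXn rmorph1 /= map_polyX -(factor_Xn_sub_1 prim_z).
  rewrite -(big_map (fun i => z ^+ i) xpredT (fun x => 'X - x%:P)).
  apply: uniq_roots_dvdp; last first.
    rewrite uniq_rootsE map_inj_in_uniq ?iota_uniq // => i j.
    rewrite !mem_index_iota => /andP[_ lt_iN] /andP[_ lt_jN] /eqP.
    by rewrite (eq_prim_root_expr prim_z) !modn_small // => /eqP.
  apply/allP => _ /mapP[i _ ->]; have := exp_prim_root prim_z i.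
  move: (z ^+ i) (N %/ gcdn i N)%N (dvdn_div (dvdn_gcdr i N)) => w e e_dvd
    prim_w.
  pose phi : {rmorphism {poly int} -> algC} := horner_eval w \o map_poly intr.
  have phiX : phi 'X = w by rewrite /phi /= map_polyX /horner_eval hornerX.
  rewrite /root -[_.[_]]/(phi _) rmorphM rmorphB rmorphXn rmorph1 phiX mulf_eq0.
  (* An odd order [e] divides [t], so q^t - 1 vanishes at [w]. For even [e], the shift by [e] is
     iterated [N / e] times. *)
  have [odd_e|even_e] := boolP (odd e).
    move: e_dvd; rewrite /N Gauss_dvdr ?coprimeXr ?coprimen2 //.
    by rewrite (prim_order_dvd prim_w) => /eqP->; rewrite subrr eqxx.
  rewrite -phiX in prim_w; apply/orP; right; rewrite rmorphB subr_eq0;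
    apply/eqP; symmetry.
  have [c ->] := dvdnP e_dvd; elim: c => [|c IHc]; first by rewrite mul0n addn0.
  by rewrite mulSn addnC -addnA addnC qEuler_shift // addnC.
exists f; apply: (@mulfI _ ('X^t - 1)); last by rewrite Df qintE mulrA.
rewrite subr_eq0; apply/eqP => /(congr1 (fun p : {poly int} => p`_0)).
by rewrite coefXn coef1; case: t odd_t {N D N_gt0 qintE Df}.
Qed.

(** * Values at q = -1, the case [e = 2] of the preceding section *)

Lemma prim_root_N1 : 2.-primitive_root (-1 : int).
Proof.
by apply/andP; split=> //; apply/forallP=> -[[|[|//]] lti] /=;
  rewrite unity_rootE.
Qed.

Lemma qEuler_even_at_N1 E n : is_qEuler E -> (E (2 * n)%N).[-1] = 1.
Proof.
move=> hE; pose phi : {rmorphism {poly int} -> int} := horner_eval (-1).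
have prim2 : 2.-primitive_root (phi 'X)
  by rewrite /phi /= /horner_eval hornerX prim_root_N1.
elim: n => [|n IHn]; last by rewrite mulnS addnC -[_.[_]]/(phi _) (qEuler_shift
  prim2).
have := qEuler_rec 0 hE; rewrite big_ord1 /= subnn qcosh_num0.
rewrite !mulr1 muln0 => ->.
by rewrite hornerE.
Qed.

Lemma qbin_even_shift_at_N1 n k :
  (qbin n.+2 k.+2).[-1] = (qbin n k).[-1] + (qbin n k.+2).[-1].
Proof.
pose phi : {rmorphism {poly int} -> int} := horner_eval (-1).
have prim2 : 2.-primitive_root (phi 'X)
  by rewrite /phi /= /horner_eval hornerX prim_root_N1.
by have := qbin_shift prim2 n k.+2; rewrite addn2 subn2 addrC.
Qed.

(** The q-Pascal rule applied twice. Its middle terms combine into a multiple of 1 + q, which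
    simplifies the derivative at -1. *)
Lemma qbin_SS n k : qbin n.+2 k.+2 = qbin n k
  + 'X^(k.+1) * (1 + 'X) * qbin n k.+1 + 'X^(k.+2 * 2) * qbin n k.+2.
Proof. by rewrite /= muln2 -addnn exprD !exprSr; ring. Qed.

Lemma qbin_even_odd_at_N1 m l : (qbin (2 * m) (2 * l).+1).[-1] = 0.
Proof.
elim: m l => [|m IHm] [|l]; rewrite ?mulnS ?hornerC ?horner0 //.
  have -> : (qbin (2 + 2 * m) 1).[-1] = (qbin (2 * m) 1).[-1].
    have step k : qbin k.+1 1 = 1 + 'X * qbin k 1 by rewrite /= qbin0.
    by rewrite !step !hornerE; ring.
  exact: (IHm 0%N).
rewrite !addSn !add0n qbin_even_shift_at_N1 IHm add0r.
by rewrite -[(2 * l).+3]/(2 + (2 * l).+1)%N addnS -mulnS IHm.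
Qed.

Lemma qbin_even_at_N1 m l : (qbin (2 * m) (2 * l)).[-1] = 'C(m, l)%:R.
Proof.
elim: m l => [|m IHm] [|l]; rewrite ?(muln0 2) ?qbin0 ?bin0 -?polyC1 ?hornerC //.
rewrite !mulnS !addSn !add0n qbin_even_shift_at_N1 IHm -(add2n (2 * l)) -mulnS.
by rewrite IHm binS natrD addrC.
Qed.

(** * Derivatives of q-binomials at q = -1 *)

Lemma mul_bin_leftZ m l :
  (l%:Z + 1) * 'C(m, l.+1)%:Z = (m%:Z - l%:Z) * 'C(m, l)%:Z.
Proof.
have := mul_bin_left m l; have [le_lm|lt_ml] := leqP l m; last first.
  by rewrite (bin_small lt_ml) (bin_small (leqW lt_ml)) !mulr0.
by move/(congr1 Posz); rewrite !PoszM -subzn // -addn1 PoszD.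
Qed.

Lemma deriv_qbin_SS n k : (qbin n.+2 k.+2)^`().[-1] =
  (qbin n k)^`().[-1] + (-1) ^+ k.+1 * (qbin n k.+1).[-1]
  + ((qbin n k.+2)^`().[-1] - (2 * k.+2)%:Z * (qbin n k.+2).[-1]).
Proof.
have odd_term a (p : {poly int}) :
    ('X^a * (1 + 'X) * p)^`().[-1] = (-1) ^+ a * p.[-1].
  rewrite !derivM derivD derivX -polyC1 derivC add0r.
  by rewrite !(hornerD, hornerM) hornerX !hornerC hornerXn subrr; ring.
have even_term a (p : {poly int}) :
    ('X^(2 * a) * p)^`().[-1] = p^`().[-1] - (2 * a)%:Z * p.[-1].
  rewrite derivM derivXn hornerD !hornerM hornerMn !hornerXn exprM sqrrN
    !expr1n mul1r.
  case: a => [|a]; first by rewrite muln0 !mulr0n mul0r add0r subr0.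
  rewrite {1}mulnS addSn exprS exprM sqrrN !expr1n mulr1 mulNrn natz; ring.
by rewrite qbin_SS !derivD !hornerD odd_term mulnC even_term.
Qed.

Lemma deriv_qbin_even_at_N1 m l : (qbin (2 * m) (2 * l))^`().[-1]
  = - (2 * l%:Z * (m%:Z - l%:Z) * 'C(m, l)%:Z).
Proof.
elim: m l => [|m IHm] [|l];
  rewrite ?(muln0 2) ?qbin0 ?mulr0 ?mul0r ?oppr0 -?polyC1 ?derivC ?horner0 //.
rewrite !mulnS !addSn !add0n deriv_qbin_SS qbin_even_odd_at_N1 mulr0 addr0.
rewrite -(add2n (2 * l)) -mulnS !IHm qbin_even_at_N1 binS.
rewrite natz; move: (mul_bin_leftZ m l).
set x := 'C(m, l); set y := 'C(m, l.+1).
(* After the induction hypotheses, the two sides differ by twice the relation [L]. *)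
rewrite -(addn1 m) -(addn1 l) !PoszM !PoszD => L; lra.
Qed.

(** * Finite sums, and alternating sums of binomials *)

Lemma sum_double (V : nmodType) (F : nat -> V) n :
  (forall i, odd i -> F i = 0) ->
  \sum_(i < (2 * n).+1) F i = \sum_(k < n.+1) F (2 * k)%N.
Proof.
move=> F_odd; elim: n => [|n IHn]; first by rewrite !big_ord1.
by rewrite mulnS 2!big_ord_recr /= IHn F_odd ?addr0 /= ?oddM //
  [RHS]big_ord_recr /= mulnS.
Qed.

Lemma sum_bin_sign n : (0 < n)%N ->
  \sum_(k < n.+1) (-1) ^+ (n - k) * 'C(n, k)%:Z = 0 :> int.
Proof.
move=> n_gt0; have := exprDn (-1 : int) 1 n;
  rewrite addNr expr0n -leqn0 leqNgt n_gt0.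
by move=> /= expE; rewrite [RHS]expE; apply: eq_bigr => i _;
  rewrite expr1n mulr1 -mulr_natr natz.
Qed.

(** The absorption identity (n-k) C(n,k) = n C(n-1,k) reduces this to [sum_bin_sign] at [n - 1],
    hence the bound on [n]. *)
Lemma sum_bin_sign_linear n : (1 < n)%N ->
  \sum_(k < n.+1) (-1) ^+ (n - k) * (n - k)%:Z * 'C(n, k)%:Z = 0 :> int.
Proof.
case: n => // n; rewrite ltnS => n_gt0.
rewrite big_ord_recr /= subnn mulr0 mul0r addr0.
under eq_bigr => k _.
  rewrite -mulrA -PoszM -mul_bin_down /= subSn ?leq_ord // exprS PoszM mulrCA
    -mulrA.
  rewrite mulN1r mulrN; over.
by rewrite sumrN -mulr_sumr sum_bin_sign // mulr0 oppr0.
Qed.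

Lemma horner_deriv_sum (R : nzRingType) m (F : 'I_m -> {poly R}) x :
  (\sum_i F i)^`().[x] = \sum_i (F i)^`().[x].
Proof. by rewrite linear_sum /= horner_sum. Qed.

(** * Derivatives of the q-Euler numbers at q = -1 *)

Lemma qcosh_num_even j : qcosh_num (2 * j) = 'X^('C(2 * j, 2)).
Proof. by rewrite /qcosh_num oddM. Qed.

Lemma bin2_double j : 'C(2 * j, 2) = (j * (2 * j).-1)%N.
Proof. by rewrite bin2 -mulnA [X in X./2]mul2n doubleK. Qed.

Lemma sign_bin2_double j : (-1) ^+ 'C(2 * j, 2) = (-1) ^+ j :> int.
Proof.
rewrite bin2_double -signr_odd oddM -(signr_odd _ j).
by case: j => // j; rewrite mulnS /= oddM andbT.
Qed.

Lemma deriv_Xbin2_at_N1 j : ('X^('C(2 * j, 2)))^`().[-1]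
  = - ((-1) ^+ j * (j%:Z * (2 * j%:Z - 1))) :> int.
Proof.
rewrite derivXn hornerMn hornerXn -sign_bin2_double -mulr_natr.
have cE : 'C(2 * j, 2)%:Z = j%:Z * (2 * j%:Z - 1).
  rewrite bin2_double; case: j => // j; rewrite mulnS /= PoszM; congr (_ * _);
    lia.
by rewrite -cE natz; case: 'C(_, _) => [|c];
  rewrite ?mulr0 ?oppr0 // exprS mulN1r mulNr opprK.
Qed.

Lemma deriv_qEuler_even_at_N1 E n :
  is_qEuler E -> (E (2 * n)%N)^`().[-1] = - n%:Z.
Proof.
move=> hE; elim/ltn_ind: n => -[_|n IHn].
  have := qEuler_rec 0 hE; rewrite big_ord1 /= subnn qcosh_num0.
  rewrite !mulr1 muln0 => ->.
  by rewrite derivC horner0.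
have /(congr1 (fun p : {poly int} => p^`().[-1])) := qEuler_rec (2 * n.+1) hE.
rewrite (sum_double (F := fun i =>
    E i * (qcosh_num (2 * n.+1 - i) * qbin (2 * n.+1) i)));
  last by move=> i oi; rewrite (qEuler_odd hE) ?mul0r.
rewrite derivC horner0 horner_deriv_sum.
(* With j = n+1-k, the product rule gives E' - j(2j-1) - 2kj = E' - j(2n+1). It is written so as to
   isolate E' + k, which is zero by induction for [k <= n]. *)
have termE (k : 'I_n.+2) : (E (2 * k)%N * (qcosh_num (2 * n.+1 - 2 * k) *
    qbin (2 * n.+1) (2 * k)))^`().[-1] = (-1) ^+ (n.+1 - k) * 'C(n.+1, k)%:Z *
   ((E (2 * k)%N)^`().[-1] + k%:Z - n.+1%:Z - 2 * n%:Z * (n.+1 - k)%:Z).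
  have le_kn : (k <= n.+1)%N by rewrite leq_ord.
  rewrite -mulnBr qcosh_num_even; set j := (n.+1 - k)%N.
  have nE : n.+1%:Z = k%:Z + j%:Z by rewrite -PoszD subnKC.
  rewrite !derivM !hornerD !hornerM !hornerD !hornerM hornerXn
    deriv_Xbin2_at_N1.
  rewrite sign_bin2_double qbin_even_at_N1 deriv_qbin_even_at_N1.
  rewrite (qEuler_even_at_N1 _ hE) !natz nE.
  have -> : n%:Z = k%:Z + j%:Z - 1 by lia.
  ring.
rewrite (eq_bigr _ (fun k _ => termE k)).
have -> : \sum_(k < n.+2) (-1) ^+ (n.+1 - k) * 'C(n.+1, k)%:Z *
    ((E (2 * k)%N)^`().[-1] + k%:Z - n.+1%:Z - 2 * n%:Z * (n.+1 - k)%:Z) =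
  (E (2 * n.+1)%N)^`().[-1] + n.+1%:Z
  - n.+1%:Z * (\sum_(k < n.+2) (-1) ^+ (n.+1 - k) * 'C(n.+1, k)%:Z)
  - 2 * (n%:Z * \sum_(k < n.+2) (-1) ^+ (n.+1 - k) * (n.+1 - k)%:Z * 'C(n.+1,
    k)%:Z).
  have -> : (E (2 * n.+1)%N)^`().[-1] + n.+1%:Z =
      \sum_(k < n.+2) (-1) ^+ (n.+1 - k) * 'C(n.+1, k)%:Z *
        ((E (2 * k)%N)^`().[-1] + k%:Z).
    rewrite [RHS]big_ord_recr [X in _ = X + _]big1 /= => [|k _].
      by rewrite subnn binn !mul1r add0r.
    by rewrite IHn // addNr mulr0.
  rewrite !mulr_sumr -!sumrB; apply: eq_bigr => k _; ring.
rewrite sum_bin_sign // mulr0 subr0.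
(* At [n = 0] the sum itself is -1, and only the factor [n] annihilates the product. *)
have -> : n%:Z * \sum_(k < n.+2) (-1) ^+ (n.+1 - k) * (n.+1 - k)%:Z * 'C(n.+1,
  k)%:Z = 0.
  by case: (n) => [|m]; rewrite ?mul0r // sum_bin_sign_linear ?mulr0.
by rewrite mulr0 subr0 => /eqP; rewrite addr_eq0 => /eqP.
Qed.

(** * Behaviour of [2M]_{q^t} at q = -1, and the congruence *)

Lemma qint_at_N1 t M : odd t -> (qint 'X^t (2 * M)).[-1] = 0 :> int.
Proof.
move=> odd_t; elim: M => [|M IHM]; first by rewrite /qint big_ord0 horner0.
rewrite mulnS /qint !addSn !big_ord_recr !hornerD [_.[_]]IHM -!exprM !hornerXn.
by rewrite mulnS exprD -(signr_odd _ t) odd_t mulN1r add0r subrr.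
Qed.

(** The terms of exponents 2Mt and (2M+1)t contribute -2Mt + (2M+1)t = t. *)
Lemma deriv_qint_at_N1 t M : odd t ->
  (qint 'X^t (2 * M))^`().[-1] = (M * t)%:Z :> int.
Proof.
move=> odd_t; elim: M => [|M IHM]; first by rewrite /qint big_ord0 deriv0
  horner0.
rewrite mulnS /qint !addSn !big_ord_recr !derivD !hornerD [_.[_]]IHM -!exprM.
have derivE' k : ('X^(t * k))^`().[-1] = - (-1) ^+ k * (t * k)%:Z :> int.
  rewrite derivXn hornerMn hornerXn -mulr_natr natz.
  rewrite -[in RHS]signr_odd -[odd k]/(true && odd k) -odd_t -oddM signr_odd.
  by case: (t * k)%N => [|c]; rewrite ?mulr0 // exprS mulN1r opprK.
rewrite !derivE' exprS exprM sqrrN !expr1n /= add0n mulnS mulSn !PoszD !PoszM;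
  ring.
Qed.

Theorem theorem1p1 (E : nat -> {poly int}) (hE : is_qEuler E)
    (n s t : nat) (ht : odd t) :
  eqmodZq ((1 + 'X) * qint 'X^t (2 ^ s))
    (E (2 * n)%N - E (2 * n + 2 ^ s * t)%N)
    (qint 'X^t (2 ^ s)).
Proof.
have [f Df] := qint_dvd_qEuler (2 * n) s hE ht.
suff f1 : f.[-1] = 1.
  have /factor_theorem[c fE] : root (f - 1) (-1).
    by rewrite /root !hornerE f1 subrr.
  exists c; rewrite Df -[X in _ - X]mulr1 -mulrBr fE polyCN opprK polyC1; ring.
case: s Df => [|s] Df.
  (* For [s = 0] the second index is odd, so its q-Euler number vanishes, while [1]_{q^t} = 1. *)
  have odd_nt : odd (2 * n + t) by rewrite oddD oddM ht.
  move: Df; rewrite expn0 mul1n (qEuler_odd hE odd_nt).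
  by rewrite /qint big_ord1 expr0 mul1r subr0 => <-; exact: qEuler_even_at_N1.
(* Here [s] is the predecessor of the original exponent. The derivative at -1 reads 2^s t = 2^s t
   f(-1), and the nonzero factor cancels. *)
have := congr1 (fun p : {poly int} => p^`().[-1]) Df.
rewrite derivB derivM !hornerD hornerN !hornerM expnS qint_at_N1 // mul0r addr0.
rewrite -mulnA -mulnDr !(deriv_qEuler_even_at_N1 _ hE) deriv_qint_at_N1 //.
rewrite opprK PoszD addKr => /esym/eqP.
rewrite -[eqbRHS]mulr1 => /eqP/mulfI; apply.
by rewrite -lt0n muln_gt0 expn_gt0 /= odd_gt0.
Qed.
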